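(* Let $(\mathscr C,A,\psi)$ be an entwining structure. Then the forgetful functor $S_\psi : {_A^{\mathscr C}}Ctr(\psi)\longrightarrow {^{\mathscr C}}Ctr$ is separable if and only if there exists $\lambda \in W_1$ such that $\lambda^{X1}(f)\lambda^{X2}(f)=\epsilon_X(f)\cdot 1 \in A$ for all $f\in \mathscr C(X,X)$, $X\in Ob(\mathscr C)$.
   Context: $K$ is a field, $(U',U):=Hom_K(U',U)$. $\mathscr C$ is a coalgebra with several objects ($\delta_{XYZ}:\mathscr C(X,Z)\to\mathscr C(Y,Z)\otimes\mathscr C(X,Y)$, $f\mapsto f_{Y1}\otimes f_{Y2}$, counits $\epsilon_X$). $(\mathscr C,A,\psi)$ is an entwining structure: $A$ a $K$-algebra, $\psi_{XY}:\mathscr C(X,Y)\otimes A\to A\otimes\mathscr C(X,Y)$, $f\otimes a\mapsto a_\psi\otimes f^\psi$, with $a_\psi\otimes\delta_{XYZ}(f^\psi)=a_{\psi\psi}\otimes f_{Y1}^\psi\otimes f_{Y2}^\psi$, $(ab)_\psi\otimes f^\psi=a_\psi b_\psi\otimes f^{\psi\psi}$, $\psi(f\otimes1)=1\otimes f$, $a_\psi\epsilon_Z(g^\psi)=\epsilon_Z(g)a$. ${^\mathscr C}Ctr$ is the category of left $\mathscr C$-contramodules (vector spaces $\mathcal M(X)$ with $\pi_{XY}:(\mathscr C(X,Y),\mathcal M(Y))\to\mathcal M(X)$, coassociative and counital); ${_A^{\mathscr C}}Ctr(\psi)$ is the category of entwined contramodules (contramodules with left $A$-module structures $\mu_X:\mathcal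 M(X)\to(A,\mathcal M(X))$ satisfying $\mu_X\circ\pi_{XY}=(A,\pi_{XY})\circ(\psi_{XY},\mathcal M(Y))\circ(\mathscr C(X,Y),\mu_Y)$). $S_\psi$ forgets the $A$-module structure. $W_1$ is the space of collections $\lambda=\{\lambda^X:\mathscr C(X,X)\to A\otimes A\}_X$, $\lambda^X(f)=\lambda^{X1}(f)\otimes\lambda^{X2}(f)$ (summation suppressed), such that $\lambda^{Y1}(f_{Y1})\otimes\lambda^{Y2}(f_{Y1})\otimes f_{Y2}=\lambda^{X1}(f_{X2})_\psi\otimes\lambda^{X2}(f_{X2})_\psi\otimes f_{X1}^{\psi\psi}$ in $A\otimes A\otimes\mathscr C(X,Y)$ for $f\in\mathscr C(X,Y)$, and $\lambda^{Z1}(g)\otimes\lambda^{Z2}(g)a=a_\psi\lambda^{Z1}(g^\psi)\otimes\lambda^{Z2}(g^\psi)$ for $g\in\mathscr C(Z,Z)$, $a\in A$. *)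

(* Defs.v *)
From HB Require Import structures.
From mathcomp Require Import all_boot all_algebra.
Unset Printing Implicit Defensive.
Import GRing.Theory.
Local Open Scope ring_scope.

(* Tensors.  An element of U (x) V is written, Sweedler-style, as a finite  *)
(* formal sum  sum_i u_i (x) v_i,  represented by the list of its terms.    *)
(* Two formal sums denote the same element of U (x) V iff they have the     *)
(* same image under every bilinear map out of U x V (universal property of  *)
(* the tensor product).  Same for triple tensors with trilinear maps.       *)

Definition tens2 {K : fieldType} (U V : lmodType K) := seq (U * V).
Definition tens3 {K : fieldType} (U V W : lmodType K) := seq (U * V * W).

Definition bilinear_map {K : fieldType} {U V W : lmodType K} (b : U -> V -> W) :=
  (forall v, linear (fun u => b u v)) /\ (forall u, linear (b u)).

Definition trilinear_map {K : fieldType} {U V W T : lmodType K}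
  (t : U -> V -> W -> T) :=
  [/\ (forall v w, linear (fun u => t u v w)),
      (forall u w, linear (fun v => t u v w)) &
      (forall u v, linear (t u v))].

Definition tev2 {K : fieldType} {U V W : lmodType K} (b : U -> V -> W)
  (s : tens2 U V) : W := \sum_(p <- s) b p.1 p.2.

Definition tev3 {K : fieldType} {U V W T : lmodType K} (t : U -> V -> W -> T)
  (s : tens3 U V W) : T := \sum_(p <- s) t p.1.1 p.1.2 p.2.

Definition teq2 {K : fieldType} {U V : lmodType K} (s t : tens2 U V) :=
  forall (W : lmodType K) (b : U -> V -> W), bilinear_map b -> tev2 b s = tev2 b t.

Definition teq3 {K : fieldType} {U V W : lmodType K} (s t : tens3 U V W) :=
  forall (T : lmodType K) (b : U -> V -> W -> T), trilinear_map b ->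
    tev3 b s = tev3 b t.

(* scalar multiple of a tensor; the sum of tensors is concatenation ++ *)
Definition tscale2 {K : fieldType} {U V : lmodType K} (k : K) (s : tens2 U V)
  : tens2 U V := [seq (k *: p.1, p.2) | p <- s].

Record coalgebra (K : fieldType) := Coalgebra {
  Ob : Type;
  Hc : Ob -> Ob -> lmodType K;
  delta : forall X Y Z : Ob, Hc X Z -> tens2 (Hc Y Z) (Hc X Y);
  eps : forall X : Ob, Hc X X -> K;
  delta_linear : forall X Y Z (k : K) (f g : Hc X Z),
    teq2 (@delta X Y Z (k *: f + g)) (tscale2 k (@delta X Y Z f) ++ @delta X Y Z g);
  eps_linear : forall X (k : K) (f g : Hc X X),
    @eps X (k *: f + g) = k * @eps X f + @eps X g;
  delta_coassoc : forall X Y Z W (f : Hc X W),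
    teq3 [seq (p.1, q.1, q.2) | p <- @delta X Z W f, q <- @delta X Y Z p.2]
         [seq (q.1, q.2, p.2) | p <- @delta X Y W f, q <- @delta Y Z W p.1];
  delta_counit_r : forall X Y (f : Hc X Y),
    \sum_(p <- @delta X X Y f) @eps X p.2 *: p.1 = f;
  delta_counit_l : forall X Y (f : Hc X Y),
    \sum_(p <- @delta X Y Y f) @eps Y p.1 *: p.2 = f
}.

Arguments Ob {K}.
Arguments Hc {K} c.
Arguments delta {K} c X Y Z.
Arguments eps {K} c X.

Record entwining (K : fieldType) (C : coalgebra K) := Entwining {
  alg : algType K;
  psi : forall X Y : Ob C, Hc C X Y -> alg -> tens2 alg (Hc C X Y);
  psi_linear_l : forall X Y (a : alg) (k : K) (f g : Hc C X Y),
    teq2 (psi X Y (k *: f + g) a) (tscale2 k (psi X Y f a) ++ psi X Y g a);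
  psi_linear_r : forall X Y (f : Hc C X Y) (k : K) (a b : alg),
    teq2 (psi X Y f (k *: a + b)) (tscale2 k (psi X Y f a) ++ psi X Y f b);
  psi_delta : forall X Y Z (f : Hc C X Z) (a : alg),
    teq3 [seq (p.1, q.1, q.2) | p <- psi X Z f a, q <- delta C X Y Z p.2]
         (flatten [seq [seq (r.1, r.2, q.2) | r <- psi Y Z p.1 q.1]
                  | p <- delta C X Y Z f, q <- psi X Y p.2 a]);
  psi_mul : forall X Y (f : Hc C X Y) (a b : alg),
    teq2 (psi X Y f (a * b))
         [seq (p.1 * q.1, q.2) | p <- psi X Y f a, q <- psi X Y p.2 b];
  psi_one : forall X Y (f : Hc C X Y), teq2 (psi X Y f 1) [:: (1, f)];
  psi_eps : forall Z (g : Hc C Z Z) (a : alg),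
    \sum_(p <- psi Z Z g a) eps C Z p.2 *: p.1 = eps C Z g *: a
}.

Arguments entwining {K}.
Arguments alg {K C}.
Arguments psi {K C} e X Y.

(* Left C-contramodules:  pi X Y : Hom_K(C(X,Y), M(Y)) -> M(X).              *)
(* Elements of Hom_K(U,V) are the linear functions U -> V; pi is only        *)
(* constrained on linear arguments.                                          *)

Record contramodule (K : fieldType) (C : coalgebra K) := Contramodule {
  cmod : Ob C -> lmodType K;
  cpi : forall X Y : Ob C, (Hc C X Y -> cmod Y) -> cmod X;
  cpi_linear : forall X Y (k : K) (phi chi : Hc C X Y -> cmod Y),
    linear phi -> linear chi ->
    cpi X Y (fun f => k *: phi f + chi f) = k *: cpi X Y phi + cpi X Y chi;
  (* coassociativity: pi_XY o (C(X,Y), pi_YZ) = pi_XZ o (delta_XYZ, M(Z)),  *)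
  (* via Hom(C(X,Y), Hom(C(Y,Z), M(Z))) = Hom(C(Y,Z) (x) C(X,Y), M(Z))       *)
  cpi_coassoc : forall X Y Z (phi : Hc C X Y -> Hc C Y Z -> cmod Z),
    bilinear_map phi ->
    cpi X Y (fun g => cpi Y Z (phi g))
    = cpi X Z (fun f => tev2 (fun h g => phi g h) (delta C X Y Z f));
  (* counitality: pi_XX o (eps_X, M(X)) = id, via M(X) = Hom(K, M(X)) *)
  cpi_counit : forall X (m : cmod X), cpi X X (fun f => eps C X f *: m) = m
}.

Arguments contramodule {K}.
Arguments cmod {K C} c X.
Arguments cpi {K C} c X Y.

Definition is_ctr_hom {K : fieldType} {C : coalgebra K} (M N : contramodule C)
  (xi : forall X, cmod M X -> cmod N X) :=
  (forall X, linear (xi X)) /\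
  (forall X Y (phi : Hc C X Y -> cmod M Y), linear phi ->
     xi X (cpi M X Y phi) = cpi N X Y (fun f => xi Y (phi f))).

(* Entwined contramodules:  mu X : M(X) -> Hom_K(A, M(X)),                   *)
(*   emu M X m a  =  mu_X(m)(a)  =  a . m   (a left A-module structure)     *)

Record entwined_contramodule (K : fieldType) (C : coalgebra K)
    (E : entwining C) := EntwinedContramodule {
  ectr :> contramodule C;
  emu : forall X : Ob C, cmod ectr X -> alg E -> cmod ectr X;
  emu_bilinear : forall X, bilinear_map (emu X);
  emu_assoc : forall X (m : cmod ectr X) (a b : alg E),
    emu X (emu X m b) a = emu X m (a * b);
  emu_one : forall X (m : cmod ectr X), emu X m 1 = m;
  emu_cpi : forall X Y (phi : Hc C X Y -> cmod ectr Y) (a : alg E), linear phi ->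
    emu X (cpi ectr X Y phi) a
    = cpi ectr X Y (fun f => tev2 (fun a' f' => emu Y (phi f') a') (psi E X Y f a))
}.

Arguments entwined_contramodule {K C}.
Arguments ectr {K C E}.
Arguments emu {K C E} e X.

Definition is_ectr_hom {K : fieldType} {C : coalgebra K} {E : entwining C}
  (M N : entwined_contramodule E) (xi : forall X, cmod M X -> cmod N X) :=
  is_ctr_hom M N xi /\
  (forall X (m : cmod M X) (a : alg E), xi X (emu M X m a) = emu N X (xi X m) a).

(* Separability of S_psi : A^C Ctr(psi) -> ^C Ctr  (the forgetful functor,   *)
(* identity on underlying families of maps):  there is a family             *)
(*   P_{M,N} : Hom(S M, S N) -> Hom(M, N),                                  *)
(* natural in M and N, with P_{M,N}(S xi) = xi.  Morphisms are compared     *)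
(* pointwise.                                                               *)

Definition S_psi_separable {K : fieldType} {C : coalgebra K} (E : entwining C) :=
  exists P : forall M N : entwined_contramodule E,
      (forall X, cmod M X -> cmod N X) -> (forall X, cmod M X -> cmod N X),
    [/\ (forall (M N : entwined_contramodule E) g, is_ctr_hom M N g -> is_ectr_hom M N (P M N g)),
        (forall (M N : entwined_contramodule E) g, is_ectr_hom M N g -> forall X m, P M N g X m = g X m) &
        (forall (M M' N N' : entwined_contramodule E) alpha beta g,
           is_ectr_hom M' M alpha -> is_ectr_hom N N' beta -> is_ctr_hom M N g ->
           forall X m,
             P M' N' (fun Y x => beta Y (g Y (alpha Y x))) X m
             = beta X (P M N g X (alpha X m)))].

Definition W1 {K : fieldType} {C : coalgebra K} (E : entwining C)
  (lam : forall X : Ob C, Hc C X X -> tens2 (alg E) (alg E)) :=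
  [/\
      (forall X (k : K) (f g : Hc C X X),
         teq2 (lam X (k *: f + g)) (tscale2 k (lam X f) ++ lam X g)),
      (forall X Y (f : Hc C X Y),
         teq3 [seq (q.1, q.2, p.2) | p <- delta C X Y Y f, q <- lam Y p.1]
              (flatten (flatten
                 [seq [seq [seq (r.1, s.1, s.2) | s <- psi E X Y r.2 q.2]
                      | r <- psi E X Y p.1 q.1]
                 | p <- delta C X X Y f, q <- lam X p.2]))) &
      (forall Z (g : Hc C Z Z) (a : alg E),
         teq2 [seq (q.1, q.2 * a) | q <- lam Z g]
              [seq (p.1 * q.1, q.2) | p <- psi E Z Z g a, q <- lam Z p.2])].

(* Main.v *)
(* Given lambda, a contramodule morphism g is averaged to
   m |-> pi_XX (f |-> lambda1(f) g(lambda2(f) m)).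
   Conversely, for an A-module U the free contramodule F_X(U) = Hom(C(-, X), U)
   is entwined, and contramodule (resp. entwined) morphisms F_X(U) -> N are the
   linear (resp. A-linear) maps U -> N(X).  Hence a natural retraction P turns
   linear maps l : U -> N(X) into A-linear ones, naturally in U and N, and fixes
   the A-linear ones.  The universal linear map out of A is
   y |-> eps (1 (x) y) : A -> F_X(A (x) A)(X); its average at 1 is a linear map
   lambda : C(X, X) -> A (x) A, and any other l : A -> N(X) has average
   pi_XX (f |-> lambda1(f) l(lambda2(f))) at 1.  The conditions on lambda come
   from averaging suitable maps l in two ways. *)
Require Import Defs.
From HB Require Import structures.
From mathcomp Require Import all_boot all_algebra.
From mathcomp Require Import boolp functions.
Import GRing.Theory.
Local Open Scope ring_scope.
Local Open Scope quotient_scope.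

(** * Linear maps and tensors *)

Section TensorSums.
Context {K : fieldType}.

Definition linear_bundle {U V : lmodType K} (h : U -> V) (hl : linear h) :
  {linear U -> V} := HB.pack h (GRing.isLinear.Build K U V *:%R h hl).

Lemma linear_sum_fun {U V : lmodType K} (h : U -> V) (I : Type) (s : seq I) F :
  linear h -> h (\sum_(i <- s) F i) = \sum_(i <- s) h (F i).
Proof. by move=> hl; exact: (linear_sum (linear_bundle h hl)). Qed.

Lemma linearZ_fun {U V : lmodType K} (h : U -> V) k u :
  linear h -> h (k *: u) = k *: h u.
Proof. by move=> hl; exact: (linearZZ (linear_bundle h hl)). Qed.

Lemma linear_comp {U V W : lmodType K} {h : V -> W} {g : U -> V} :
  linear h -> linear g -> linear (fun u => h (g u)).
Proof. by move=> hl gl k u v; rewrite gl hl. Qed.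

Lemma linear_sum_of {U V : lmodType K} {I : Type} (s : seq I) (F : I -> U -> V) :
  (forall i, linear (F i)) -> linear (fun u => \sum_(i <- s) F i u).
Proof.
move=> hF k u v; rewrite scaler_sumr -big_split /=.
by apply: eq_bigr => i _; rewrite hF.
Qed.

Lemma tev2_cat {U V W : lmodType K} (b : U -> V -> W) s t :
  tev2 b (s ++ t) = tev2 b s + tev2 b t.
Proof. exact: big_cat. Qed.

Lemma tev2_scale {U V W : lmodType K} (b : U -> V -> W) k s :
  (forall v, linear (b^~ v)) -> tev2 b (tscale2 k s) = k *: tev2 b s.
Proof.
move=> bl; rewrite /tev2 big_map scaler_sumr; apply: eq_bigr => p _ /=.
by rewrite (linearZ_fun (b^~ p.2)).
Qed.

Lemma linear_tev2 {U V W W' : lmodType K} (h : W -> W') (b : U -> V -> W) s :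
  linear h -> h (tev2 b s) = tev2 (fun u v => h (b u v)) s.
Proof. by move=> hl; rewrite /tev2 linear_sum_fun. Qed.

Lemma eq_tev2 {U V W : lmodType K} (b c : U -> V -> W) s :
  (forall u v, b u v = c u v) -> tev2 b s = tev2 c s.
Proof. by move=> bc; apply: eq_bigr. Qed.

Lemma tev2_linear_fun {U V W T : lmodType K} (b : T -> U -> V -> W) s :
  (forall u v, linear (fun x => b x u v)) -> linear (fun x => tev2 (b x) s).
Proof. by move=> bl; apply: linear_sum_of. Qed.

Lemma bilinear_comp {U V W W' : lmodType K} (h : W -> W') (b : U -> V -> W) :
  linear h -> bilinear_map b -> bilinear_map (fun u v => h (b u v)).
Proof. by move=> hl [bl br]; split=> x k u v; rewrite ?bl ?br hl. Qed.

End TensorSums.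

(** * The vector space of linear maps *)

Section LinearMaps.
Context {K : fieldType}.
Implicit Types U V W : lmodType K.

Definition linear_pred U V : {pred U -> V} := fun f => `[< linear f >].

Fact linear_pred_submod U V : GRing.submod_closed (linear_pred U V).
Proof.
split=> [|a f g /asboolP hf /asboolP hg]; apply/asboolP => k u v.
  by rewrite scaler0 addr0.
by rewrite /= !fctE hf hg !scalerDr !scalerA mulrC addrACA.
Qed.
HB.instance Definition _ U V :=
  GRing.isSubmodClosed.Build K (U -> V) (linear_pred U V) (linear_pred_submod U V).

(** A subtype of the function space, so that linear maps inherit its module structure and can serve
    as the values of a contramodule, which have to be of type [lmodType]. *)
Record lin U V := Lin { lin_fun :> U -> V; _ : lin_fun \in linear_pred U V }.
HB.instance Definition _ U V := [isSub for @lin_fun U V].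
HB.instance Definition _ U V := [Choice of lin U V by <:].
HB.instance Definition _ U V := [SubChoice_isSubLmodule of lin U V by <:].

End LinearMaps.

Section LinearMapsTheory.
Context {K : fieldType}.
Implicit Types U V W : lmodType K.

Lemma lin_linear {U V} (m : lin U V) : linear m.
Proof. by case: m => f fl; apply/asboolP. Qed.

Lemma linP {U V} (m n : lin U V) : (forall u, m u = n u) -> m = n.
Proof. by move=> mn; apply: val_inj; apply/funext. Qed.

(* The zero map when [f] is not linear. *)
Definition to_lin {U V} (f : U -> V) : lin U V := insubd 0 f.

Lemma to_linE {U V} (f : U -> V) u : linear f -> to_lin f u = f u.
Proof.
move=> fl; rewrite /to_lin (_ : lin_fun U V = val) // val_insubd.
by rewrite ifT //; apply/asboolP.
Qed.

Lemma linDZE {U V} k (m n : lin U V) u : (k *: m + n) u = k *: m u + n u.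
Proof. by []. Qed.

End LinearMapsTheory.

(** * The tensor product as a quotient of formal sums *)

Section Tensor.
Context {K : fieldType}.
Implicit Types U V W : lmodType K.

Definition teq2b {U V} : rel (tens2 U V) := fun s t => `[< teq2 s t >].

Fact teq2b_equiv U V : equiv_class_of (@teq2b U V).
Proof.
split=> [s|s t|s t r].
- exact/asboolP.
- by apply/asboolP/asboolP => st W b bl; rewrite st.
- by move=> /asboolP st /asboolP tr; apply/asboolP => W b bl; rewrite st // tr.
Qed.
Canonical teq2b_equiv_rel U V := EquivRelPack (teq2b_equiv U V).

(** Passing to the quotient turns [teq2], made boolean classically, into plain equality, so that
    tensors can be the values of linear maps. *)
Definition tensor U V := {eq_quot (teq2b_equiv_rel U V)}.
HB.instance Definition _ U V := Choice.on (tensor U V).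
HB.instance Definition _ U V := EqQuotient.on (tensor U V).
End Tensor.

Section TensorModule.
Context {K : fieldType}.
Variables U V : lmodType K.
Implicit Types s t : tens2 U V.
Implicit Types x y z : tensor U V.

(** The map induced by [b] on the tensor product. Evaluating a chosen representative is legitimate
    when [b] is bilinear, as [tlift_pi] records. *)
Definition tlift {W : lmodType K} (b : U -> V -> W) x := tev2 b (repr x).

Lemma tlift_pi {W : lmodType K} (b : U -> V -> W) s : bilinear_map b ->
  tlift b (\pi_(tensor U V) s) = tev2 b s.
Proof.
move=> bl; have /eqmodP/asboolP st := reprK (\pi_(tensor U V) s).
exact: st.
Qed.

Lemma tensor_piP s t :
  reflect (teq2 s t) (\pi_(tensor U V) s == \pi_(tensor U V) t).
Proof. by apply: (iffP eqP) => [/eqmodP/asboolP|st]; last exact/eqmodP/asboolP. Qed.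

(** Bilinear maps separate tensors by the very definition of the quotient. Each module axiom below
    is thus pulled back from the target [W]. *)
Lemma tensorP x y :
  (forall (W : lmodType K) (b : U -> V -> W), bilinear_map b ->
    tlift b x = tlift b y) -> x = y.
Proof. by move=> xy; rewrite -[x]reprK -[y]reprK; apply/eqP/tensor_piP. Qed.

Definition tadd x y : tensor U V := \pi_(tensor U V) (repr x ++ repr y).
Definition tscale k x : tensor U V := \pi_(tensor U V) (tscale2 k (repr x)).
Definition tzero : tensor U V := \pi_(tensor U V) [::].

Lemma tlift_add {W : lmodType K} (b : U -> V -> W) x y : bilinear_map b ->
  tlift b (tadd x y) = tlift b x + tlift b y.
Proof. by move=> bl; rewrite tlift_pi // tev2_cat. Qed.

Lemma tlift_scale {W : lmodType K} (b : U -> V -> W) k x : bilinear_map b ->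
  tlift b (tscale k x) = k *: tlift b x.
Proof. by move=> bl; rewrite tlift_pi // tev2_scale //; case: bl. Qed.

Lemma tlift_zero {W : lmodType K} (b : U -> V -> W) : bilinear_map b ->
  tlift b tzero = 0.
Proof. by move=> bl; rewrite tlift_pi // /tev2 big_nil. Qed.

Let tE := (@tlift_add, @tlift_scale, @tlift_zero).

Fact taddA : associative tadd.
Proof. by move=> x y z; apply: tensorP => W b bl; rewrite !tE // addrA. Qed.
Fact taddC : commutative tadd.
Proof. by move=> x y; apply: tensorP => W b bl; rewrite !tE // addrC. Qed.
Fact tadd0 : left_id tzero tadd.
Proof. by move=> x; apply: tensorP => W b bl; rewrite !tE // add0r. Qed.
Fact taddN : left_inverse tzero (tscale (-1)) tadd.
Proof.
by move=> x; apply: tensorP => W b bl; rewrite !tE // scaleN1r addNr.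
Qed.
HB.instance Definition _ :=
  GRing.isZmodule.Build (tensor U V) taddA taddC tadd0 taddN.

Fact tscaleA a b x : tscale a (tscale b x) = tscale (a * b) x.
Proof. by apply: tensorP => W c bl; rewrite !tE // scalerA. Qed.
Fact tscale1 : left_id 1 tscale.
Proof. by move=> x; apply: tensorP => W c bl; rewrite !tE // scale1r. Qed.
Fact tscaleDr : right_distributive tscale +%R.
Proof.
by move=> k x y; apply: tensorP => W c bl; rewrite !tE // scalerDr.
Qed.
Fact tscaleDl x : {morph tscale^~ x : a b / a + b}.
Proof.
by move=> k x' ; apply: tensorP => W c bl; rewrite !tE // scalerDl.
Qed.
HB.instance Definition _ := GRing.Zmodule_isLmodule.Build K (tensor U V)
  tscaleA tscale1 tscaleDr tscaleDl.

Lemma tlift_linear {W : lmodType K} (b : U -> V -> W) :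
  bilinear_map b -> linear (tlift b).
Proof. by move=> bl k x y; rewrite tlift_add // tlift_scale. Qed.

Definition tpure (u : U) (v : V) : tensor U V := \pi_(tensor U V) [:: (u, v)].

Lemma tlift_pure {W : lmodType K} (b : U -> V -> W) u v : bilinear_map b ->
  tlift b (tpure u v) = b u v.
Proof. by move=> bl; rewrite tlift_pi // /tev2 big_seq1. Qed.

Lemma tpure_bilinear : bilinear_map tpure.
Proof.
split=> x k y z; apply: tensorP => W b bl;
  by rewrite (tlift_linear _ bl) !tlift_pure //; case: bl => bl br; rewrite ?bl ?br.
Qed.

Lemma tensor_pi s : \pi_(tensor U V) s = tev2 tpure s.
Proof.
apply: tensorP => W b bl; rewrite tlift_pi // (linear_tev2 (tlift b)).
  by apply: eq_tev2 => u v; rewrite tlift_pure.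
exact: tlift_linear.
Qed.

(** [tpure] is the universal bilinear map, so testing on it alone replaces the quantification over
    all bilinear maps. *)
Lemma teq2P s t : tev2 tpure s = tev2 tpure t -> teq2 s t.
Proof. by rewrite -!tensor_pi => /eqP /tensor_piP. Qed.

Lemma tensor_linear_ext {W : lmodType K} (g h : tensor U V -> W) :
  linear g -> linear h -> (forall u v, g (tpure u v) = h (tpure u v)) -> g =1 h.
Proof.
move=> gl hl gh x; rewrite -[x]reprK tensor_pi.
by rewrite (linear_tev2 g) // (linear_tev2 h) //; apply: eq_tev2.
Qed.

End TensorModule.
Arguments tpure {K U V}.
Arguments tlift {K U V W}.

(** * Left modules over the algebra and their tensor products with vector spaces *)

Section Modules.
Context {K : fieldType} (A : algType K).

(** The argument order is that of [emu]: [act m a] stands for a.m, and the value of an entwined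
    contramodule at an object is an [amodule] without any rearrangement (see [fiber]). *)
Record amodule := AModule {
  amod :> lmodType K;
  act : amod -> A -> amod;
  act_bilinear : bilinear_map act;
  act_assoc : forall m a b, act (act m b) a = act m (a * b);
  act_one : forall m, act m 1 = m
}.

Fact regular_bilinear : bilinear_map (fun m a : A => a * m).
Proof.
split=> x k y z; first by rewrite mulrDr scalerAr.
by rewrite mulrDl scalerAl.
Qed.
Definition regular := AModule A (fun m a => a * m) regular_bilinear
  (fun m a b => mulrA a b m) (fun m => mul1r m).

Variables (M : amodule) (V : lmodType K).

Fact tensor_act_bilinear_in a :
  bilinear_map (fun (m : M) (v : V) => tpure (act M m a) v).
Proof.
have [bl br] := act_bilinear M; have [pl pr] := tpure_bilinear M V.
by split=> x k y z; rewrite ?bl ?pl ?pr.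
Qed.

Definition tensor_act (t : tensor M V) a := tlift (fun m v => tpure (act M m a) v) t.

Lemma tensor_act_linear a : linear (tensor_act^~ a).
Proof. exact/tlift_linear/tensor_act_bilinear_in. Qed.

Lemma tensor_act_pure m v a : tensor_act (tpure m v) a = tpure (act M m a) v.
Proof. exact/tlift_pure/tensor_act_bilinear_in. Qed.

Fact tensor_act_bilinear : bilinear_map tensor_act.
Proof.
split=> [a|t]; first exact: tensor_act_linear.
apply: tev2_linear_fun => m v k a b.
by rewrite (act_bilinear M).2 (tpure_bilinear M V).1.
Qed.

Fact tensor_act_assoc t a b : tensor_act (tensor_act t b) a = tensor_act t (a * b).
Proof.
move: t; apply: tensor_linear_ext.
- exact: (linear_comp (tensor_act_linear a) (tensor_act_linear b)).
- exact: tensor_act_linear.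
- by move=> m v; rewrite !tensor_act_pure act_assoc.
Qed.

Fact tensor_act_one t : tensor_act t 1 = t.
Proof.
move: t; apply: tensor_linear_ext => //; first exact: tensor_act_linear.
by move=> m v; rewrite tensor_act_pure act_one.
Qed.

Definition tensor_module :=
  AModule (tensor M V) tensor_act tensor_act_bilinear tensor_act_assoc tensor_act_one.

End Modules.

(** * The coalgebra and entwining axioms evaluated on multilinear maps *)

Section SweedlerSums.
Context {K : fieldType}.

Lemma tev2_linear_arg {T U V W : lmodType K} (s : T -> tens2 U V)
    (b : U -> V -> W) :
  (forall k f g, teq2 (s (k *: f + g)) (tscale2 k (s f) ++ s g)) ->
  bilinear_map b -> linear (fun f => tev2 b (s f)).
Proof.
by move=> sl bl k f g; rewrite sl // tev2_cat tev2_scale //; case: bl.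
Qed.

Context {C : coalgebra K}.

Lemma delta_linear_map X Y Z {W : lmodType K} (b : Hc C Y Z -> Hc C X Y -> W) :
  bilinear_map b -> linear (fun f => tev2 b (delta C X Y Z f)).
Proof. exact/tev2_linear_arg/delta_linear. Qed.

Lemma coassocE {X Y Z T} (f : Hc C X T) {W : lmodType K}
    (t : Hc C Z T -> Hc C Y Z -> Hc C X Y -> W) : trilinear_map t ->
  tev2 (fun u v => tev2 (t u) (delta C X Y Z v)) (delta C X Z T f)
  = tev2 (fun u w => tev2 (fun u v => t u v w) (delta C Y Z T u)) (delta C X Y T f).
Proof.
move=> tl; have := delta_coassoc _ _ X Y Z T f _ _ tl.
by rewrite /tev3 !big_allpairs_dep.
Qed.

Lemma counit_lE X Y (f : Hc C X Y) {W : lmodType K} (h : Hc C X Y -> W) :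
  linear h -> tev2 (fun u v => eps C Y u *: h v) (delta C X Y Y f) = h f.
Proof.
move=> hl; rewrite -[in RHS](delta_counit_l _ _ X Y f) linear_sum_fun //.
by apply: eq_bigr => p _; rewrite linearZ_fun.
Qed.

Lemma counit_rE X Y (f : Hc C X Y) {W : lmodType K} (h : Hc C X Y -> W) :
  linear h -> tev2 (fun u v => eps C X v *: h u) (delta C X X Y f) = h f.
Proof.
move=> hl; rewrite -[in RHS](delta_counit_r _ _ X Y f) linear_sum_fun //.
by apply: eq_bigr => p _; rewrite linearZ_fun.
Qed.

Lemma eps_scale_linear X {W : lmodType K} (w : W) :
  linear (fun f : Hc C X X => eps C X f *: w).
Proof. by move=> k f g; rewrite eps_linear scalerDl scalerA. Qed.

Context {E : entwining C}.

Lemma psi_linear_map_l X Y a {W : lmodType K} (b : alg E -> Hc C X Y -> W) :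
  bilinear_map b -> linear (fun f => tev2 b (psi E X Y f a)).
Proof. exact/tev2_linear_arg/psi_linear_l. Qed.

Lemma psi_linear_map_r X Y f {W : lmodType K} (b : alg E -> Hc C X Y -> W) :
  bilinear_map b -> linear (fun a => tev2 b (psi E X Y f a)).
Proof. exact/tev2_linear_arg/psi_linear_r. Qed.

Lemma psi_mulE X Y (f : Hc C X Y) a b {W : lmodType K}
    (t : alg E -> Hc C X Y -> W) : bilinear_map t ->
  tev2 t (psi E X Y f (a * b))
  = tev2 (fun a' f' => tev2 (fun b' => t (a' * b')) (psi E X Y f' b)) (psi E X Y f a).
Proof. by move=> tl; rewrite psi_mul // /tev2 big_allpairs_dep. Qed.

Lemma psi_oneE X Y (f : Hc C X Y) {W : lmodType K} (t : alg E -> Hc C X Y -> W) :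
  bilinear_map t -> tev2 t (psi E X Y f 1) = t 1 f.
Proof. by move=> tl; rewrite psi_one // /tev2 big_seq1. Qed.

Lemma psi_epsE Z (g : Hc C Z Z) a {W : lmodType K} (h : alg E -> W) : linear h ->
  tev2 (fun a' f => eps C Z f *: h a') (psi E Z Z g a) = eps C Z g *: h a.
Proof.
move=> hl; rewrite -linearZ_fun // -psi_eps linear_sum_fun //.
by apply: eq_bigr => p _; rewrite linearZ_fun.
Qed.

Lemma psi_deltaE X Y Z (f : Hc C X Z) a {W : lmodType K}
    (t : alg E -> Hc C Y Z -> Hc C X Y -> W) : trilinear_map t ->
  tev2 (fun a' f' => tev2 (t a') (delta C X Y Z f')) (psi E X Z f a)
  = tev2 (fun u v => tev2 (fun b v' => tev2 (fun b' u' => t b' u' v')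
      (psi E Y Z u b)) (psi E X Y v a)) (delta C X Y Z f).
Proof.
move=> tl; have := psi_delta _ _ _ X Y Z f a _ _ tl.
rewrite /tev3 big_allpairs_dep big_flatten big_allpairs_dep => ptE; apply: etrans ptE _.
by apply: eq_bigr => p _; apply: eq_bigr => q _; rewrite big_map.
Qed.

End SweedlerSums.

(** * Free entwined contramodules *)

Section FreeContramodule.
Context {K : fieldType} {C : coalgebra K}.
Variables (X0 : Ob C) (V : lmodType K).

Definition free_mod X : lmodType K := lin (Hc C X X0) V.

(** This is Hom(delta, V) after currying Hom(C(X,Y), Hom(C(Y,X0), V)) into Hom(C(Y,X0) (x) C(X,Y),
    V). Bundling by [to_lin] is faithful for linear [phi]. *)
Definition free_cpi X Y (phi : Hc C X Y -> free_mod Y) : free_mod X :=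
  to_lin (fun f => tev2 (fun h g => phi g h) (delta C X Y X0 f)).

Lemma free_cpiE X Y (phi : Hc C X Y -> free_mod Y) f : linear phi ->
  free_cpi X Y phi f = tev2 (fun h g => phi g h) (delta C X Y X0 f).
Proof.
move=> phil; apply: to_linE; apply: delta_linear_map; split=> x k g h.
  exact: lin_linear.
by rewrite phil.
Qed.

Fact free_cpi_linear X Y k (phi chi : Hc C X Y -> free_mod Y) :
  linear phi -> linear chi ->
  free_cpi X Y (fun f => k *: phi f + chi f)
  = k *: free_cpi X Y phi + free_cpi X Y chi.
Proof.
move=> phil chil; apply: linP => f; rewrite linDZE !free_cpiE //.
  by rewrite [in RHS]/tev2 scaler_sumr -big_split.
by move=> a g h; rewrite phil chil !scalerDr !scalerA mulrC addrACA.
Qed.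

(** Coassociativity of [delta], evaluated on the trilinear map sending (u, v, w) to [phi w v u]. *)
Fact free_cpi_coassoc X Y Z (phi : Hc C X Y -> Hc C Y Z -> free_mod Z) :
  bilinear_map phi ->
  free_cpi X Y (fun g => free_cpi Y Z (phi g))
  = free_cpi X Z (fun f => tev2 (fun h g => phi g h) (delta C X Y Z f)).
Proof.
move=> [phil phir]; apply: linP => f; rewrite !free_cpiE; first last.
- move=> k g h; rewrite -free_cpi_linear //; congr (free_cpi _ _ _).
  by apply/funext => u; rewrite phil.
- apply: delta_linear_map; split=> x k g h; last by rewrite phil.
  by rewrite phir.
have tl : trilinear_map (fun (u : Hc C Z X0) v w => phi w v u).
  by split=> x y k g h; rewrite ?phil ?phir // lin_linear.
apply/esym; apply: etrans (etrans (coassocE f _ tl) _).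
  by apply: eq_tev2 => u v; rewrite (linear_tev2 (fun m : lin _ _ => m u)).
by apply: eq_tev2 => u v; rewrite free_cpiE.
Qed.

Fact free_cpi_counit X (m : free_mod X) :
  free_cpi X X (fun f => eps C X f *: m) = m.
Proof.
apply: linP => f; rewrite free_cpiE; last exact: eps_scale_linear.
exact/counit_rE/lin_linear.
Qed.

Definition free_contramodule : contramodule C :=
  Contramodule K C free_mod free_cpi free_cpi_linear free_cpi_coassoc free_cpi_counit.

End FreeContramodule.

Section FreeEntwined.
Context {K : fieldType} {C : coalgebra K} (E : entwining C).
Variables (X0 : Ob C) (U : amodule (alg E)).

(** The action twisted by the entwining: (a.m)(f) = a_psi . m(f^psi). Multiplicativity and unitality
    of [psi] make it a module structure. *)
Definition free_act X (m : free_mod X0 U X) a : free_mod X0 U X :=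
  to_lin (fun f => tev2 (fun a' f' => act _ U (m f') a') (psi E X X0 f a)).

Fact act_lin_bilinear {W : lmodType K} (m : lin W U) :
  bilinear_map (fun (a : alg E) f => act _ U (m f) a).
Proof.
have [bl br] := act_bilinear _ U; split=> x k g h; first exact: br.
by rewrite lin_linear bl.
Qed.

Lemma free_actE X (m : free_mod X0 U X) a f :
  free_act X m a f = tev2 (fun a' f' => act _ U (m f') a') (psi E X X0 f a).
Proof. exact/to_linE/psi_linear_map_l/act_lin_bilinear. Qed.

Fact free_act_bilinear X : bilinear_map (free_act X).
Proof.
split=> [a k m n|m k a b]; apply: linP => f; rewrite linDZE !free_actE.
  rewrite [in RHS]/tev2 scaler_sumr -big_split; apply: eq_bigr => p _.
  by rewrite linDZE (act_bilinear _ U).1.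
exact/psi_linear_map_r/act_lin_bilinear.
Qed.

Fact free_act_assoc X m a b : free_act X (free_act X m b) a = free_act X m (a * b).
Proof.
apply: linP => f; rewrite !free_actE psi_mulE; last exact: act_lin_bilinear.
apply: eq_tev2 => a' f'; rewrite free_actE (linear_tev2 (fun u => act _ U u a')).
  by apply: eq_tev2 => b' f''; rewrite act_assoc.
exact: (act_bilinear _ U).1.
Qed.

Fact free_act_one X m : free_act X m 1 = m.
Proof.
apply: linP => f; rewrite free_actE psi_oneE ?act_one //.
exact: act_lin_bilinear.
Qed.

Lemma act_trilinear {V : lmodType K} X Y (phi : Hc C X Y -> lin V U) : linear phi ->
  trilinear_map (fun (a : alg E) (h : V) g => act _ U (phi g h) a).
Proof.
move=> phil; have [bl br] := act_bilinear _ U.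
split=> x y k g h; first exact: br.
  by rewrite lin_linear bl.
by rewrite phil linDZE bl.
Qed.

(** This is the compatibility of [psi] with [delta]: moving a past f and then splitting f equals
    splitting f first and moving a past both pieces. *)
Fact free_act_cpi X Y (phi : Hc C X Y -> free_mod X0 U Y) a : linear phi ->
  free_act X (free_cpi X0 U X Y phi) a
  = free_cpi X0 U X Y
      (fun f => tev2 (fun a' f' => free_act Y (phi f') a') (psi E X Y f a)).
Proof.
move=> phil; apply: linP => f; rewrite free_actE free_cpiE; last first.
  apply: psi_linear_map_l; have [bl br] := free_act_bilinear Y.
  by split=> x k g h; rewrite ?br // phil bl.
apply: etrans (etrans (psi_deltaE _ _ _ f a _ (act_trilinear _ _ _ phil)) _).
  apply: eq_tev2 => a' f'; rewrite free_cpiE //.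
  exact/(linear_tev2 (fun u => act _ U u a'))/(act_bilinear _ U).1.
apply: eq_tev2 => u v; rewrite (linear_tev2 (fun m : lin _ _ => m u)) //.
by apply: eq_tev2 => a' f'; rewrite free_actE.
Qed.

Definition free_entwined : entwined_contramodule E :=
  EntwinedContramodule K C E (free_contramodule X0 U) free_act free_act_bilinear
    free_act_assoc free_act_one free_act_cpi.

End FreeEntwined.

Section TripleTensors.
Context {K : fieldType} {U V W : lmodType K}.

Definition tpure3 (u : U) (v : V) (w : W) : tensor (tensor U V) W :=
  tpure (tpure u v) w.

(** Any trilinear map factors through [tpure3] by lifting twice, first over the inner and then over
    the outer tensor product. *)
Lemma teq3P (s t : tens3 U V W) : tev3 tpure3 s = tev3 tpure3 t -> teq3 s t.
Proof.
move=> st T b [bu bv bw].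
have bil w : bilinear_map (fun u v => b u v w) by split.
have bil' : bilinear_map (fun x w => tlift (fun u v => b u v w) x).
  split=> [w|x]; first exact: tlift_linear.
  by apply: tev2_linear_fun => u v; exact: bw.
have fl := tlift_linear _ _ _ bil'.
move/(congr1 (tlift (fun x w => tlift (fun u v => b u v w) x))): st.
rewrite /tev3 !(linear_sum_fun _ _ _ _ fl).
under eq_bigr do rewrite !tlift_pure //.
by under [RHS]eq_bigr do rewrite !tlift_pure //.
Qed.

End TripleTensors.

(** * The universal property of free contramodules *)

Section FreeUniversal.
Context {K : fieldType} {C : coalgebra K} {E : entwining C}.

Definition module_hom (U V : amodule (alg E)) (k : U -> V) :=
  linear k /\ forall u a, k (act _ U u a) = act _ V (k u) a.

Definition fiber (N : entwined_contramodule E) X : amodule (alg E) :=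
  AModule _ (cmod N X) (emu N X) (emu_bilinear _ _ _ N X) (emu_assoc _ _ _ N X)
    (emu_one _ _ _ N X).

Definition free_unit X {V : lmodType K} (v : V) : free_mod X V X :=
  to_lin (fun f => eps C X f *: v).

Lemma free_unitE X {V : lmodType K} (v : V) f : free_unit X v f = eps C X f *: v.
Proof. exact/to_linE/eps_scale_linear. Qed.

Lemma free_unit_linear X {V : lmodType K} : linear (@free_unit X V).
Proof.
move=> k u v; apply: linP => f.
by rewrite linDZE !free_unitE scalerDr !scalerA mulrC.
Qed.

(** A-linearity of the unit comes from the compatibility of [psi] with the counit. *)
Lemma free_unit_module_hom X (U : amodule (alg E)) :
  module_hom U (fiber (free_entwined E X U) X) (free_unit X).
Proof.
split; first exact: free_unit_linear.
move=> u a; apply: linP => f; rewrite free_unitE [RHS]free_actE.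
rewrite -(psi_epsE _ f a (act _ U u)); last exact: (act_bilinear _ U).2.
apply: eq_tev2 => a' f'; rewrite free_unitE.
by rewrite -(linearZ_fun (fun u => act _ U u a')) //; exact: (act_bilinear _ U).1.
Qed.

(** Every element of a free contramodule is a contraction of units, so a contramodule morphism out
    of it is determined by its values on them. *)
Lemma free_cpi_unit X Y {V : lmodType K} (h : Hc C X Y -> V) f : linear h ->
  free_cpi Y V X Y (fun g => free_unit Y (h g)) f = h f.
Proof.
move=> hl; rewrite free_cpiE; last exact: (linear_comp (free_unit_linear _) hl).
rewrite -[RHS](counit_lE _ _ f) //; apply: eq_tev2 => u v.
by rewrite free_unitE.
Qed.

Section Extension.
Context {N : entwined_contramodule E} {X : Ob C} {V : lmodType K}.
Variable l : V -> cmod N X.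
Hypothesis l_linear : linear l.

(** The morphism out of the free contramodule that corresponds to [l]. It respects contractions by
    coassociativity in [N] and restricts to [l] along the unit by counitality. *)
Definition extension Z (n : free_mod X V Z) : cmod N Z := cpi N Z X (fun f => l (n f)).

Lemma extension_ctr_hom : is_ctr_hom (free_contramodule X V) N extension.
Proof.
split=> [Z k m n|Z Y phi phil].
  rewrite /extension -cpi_linear; try exact: linear_comp l_linear (lin_linear _).
  by congr (cpi _ _ _ _); apply/funext => f; rewrite l_linear.
apply/esym; apply: etrans (cpi_coassoc _ _ N Z Y X (fun g h => l (phi g h)) _) _.
  by split=> x k g h; rewrite ?phil ?lin_linear l_linear.
congr (cpi _ _ _ _); apply/funext => f.
by rewrite [in RHS]free_cpiE // [RHS](linear_tev2 l).
Qed.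

Lemma extension_unit v : extension X (free_unit X v) = l v.
Proof.
rewrite -[RHS](cpi_counit _ _ N); congr (cpi _ _ _ _); apply/funext => f.
by rewrite free_unitE linearZ_fun.
Qed.

End Extension.

(** The entwining condition in [N] produces exactly the psi-twist that defines the action on the
    free contramodule. *)
Lemma extension_ectr_hom {N : entwined_contramodule E} {X} {U : amodule (alg E)}
    (l : U -> cmod N X) : module_hom U (fiber N X) l ->
  is_ectr_hom (free_entwined E X U) N (extension l).
Proof.
move=> [ll la]; split; first exact: extension_ctr_hom.
move=> Z n a; rewrite /extension emu_cpi; last exact: (linear_comp ll (lin_linear _)).
congr (cpi _ _ _ _); apply/funext => f; rewrite [X in l X]free_actE (linear_tev2 l) //.
by apply: eq_tev2 => a' f'; rewrite la.
Qed.

End FreeUniversal.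

(** * From a natural retraction to lambda *)

Section SeparableToCasimir.
Context {K : fieldType} {C : coalgebra K} {E : entwining C}.
Local Notation A := (alg E).
Local Notation RA := (regular A).

Variable P : forall M N : entwined_contramodule E,
  (forall X, cmod M X -> cmod N X) -> (forall X, cmod M X -> cmod N X).
Hypothesis P_hom : forall (M N : entwined_contramodule E) g,
  is_ctr_hom M N g -> is_ectr_hom M N (P M N g).
Hypothesis P_id : forall (M N : entwined_contramodule E) g,
  is_ectr_hom M N g -> forall X m, P M N g X m = g X m.
Hypothesis P_nat : forall (M M' N N' : entwined_contramodule E) alpha beta g,
  is_ectr_hom M' M alpha -> is_ectr_hom N N' beta -> is_ctr_hom M N g ->
  forall X m, P M' N' (fun Y x => beta Y (g Y (alpha Y x))) X m
    = beta X (P M N g X (alpha X m)).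

(** [P] acts on raw families of functions and naturality fixes their syntactic form; extensionality
    allows replacing them by pointwise equal ones. *)
Lemma P_ext M N g g' : (forall Z n, g Z n = g' Z n) ->
  forall X m, P M N g X m = P M N g' X m.
Proof.
move=> gg' X m; suff -> : g = g' by [].
by apply: functional_extensionality_dep => Z; apply/funext.
Qed.

(** The retraction [P] transported to maps out of [U] along the universal property: extend [l],
    apply [P], restrict to units. *)
Definition averaging {N : entwined_contramodule E} {X} {U : amodule A}
    (l : U -> cmod N X) (u : U) : cmod N X :=
  P (free_entwined E X U) N (extension l) X (free_unit X u).

Section Averaging.
Context {N : entwined_contramodule E} {X : Ob C} {U : amodule A}.
Variable l : U -> cmod N X.
Hypothesis l_linear : linear l.

Let lh : is_ctr_hom (free_entwined E X U) N (extension l) :=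
  extension_ctr_hom l l_linear.

Lemma averaging_module_hom : module_hom U (fiber N X) (averaging l).
Proof.
have [[Pl _] Pa] := P_hom _ _ _ lh.
split=> [|u a]; first exact: (linear_comp (Pl X) (free_unit_linear X)).
by rewrite /averaging (free_unit_module_hom X U).2 [LHS]Pa.
Qed.

(** Both sides are contramodule morphisms out of a free contramodule that agree on units. *)
Lemma averaging_extension Z n :
  P (free_entwined E X U) N (extension l) Z n = extension (averaging l) Z n.
Proof.
have [[_ Pc] _] := P_hom _ _ _ lh.
have ul := linear_comp (free_unit_linear X) (lin_linear n).
apply: etrans (Pc Z X _ ul).
congr (P _ _ _ _ _); apply: linP => f; apply/esym.
exact/free_cpi_unit/lin_linear.
Qed.

Lemma averaging_id : module_hom U (fiber N X) l -> averaging l =1 l.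
Proof.
move=> lA u; rewrite /averaging P_id; last exact: extension_ectr_hom.
exact: extension_unit.
Qed.

(** Naturality of [P] in the target, with the identity on the free source. *)
Lemma averaging_post {N' : entwined_contramodule E} beta : is_ectr_hom N N' beta ->
  forall u, averaging (fun u => beta X (l u)) u = beta X (averaging l u).
Proof.
move=> bh u.
have idh : is_ectr_hom (free_entwined E X U) (free_entwined E X U) (fun _ m => m).
  by [].
rewrite /averaging -(P_nat _ _ _ _ _ _ _ idh bh lh).
apply: P_ext => Z n.
by rewrite [in RHS]/extension bh.1.2 //; exact: (linear_comp l_linear (lin_linear n)).
Qed.

(** Naturality of [P] in the source, along the entwined morphism of free contramodules that extends
    [s]. *)
Lemma averaging_pre {Y} {U' : amodule A} (s : U' -> free_mod X U Y) :
  module_hom U' (fiber (free_entwined E X U) Y) s ->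
  forall u, averaging (fun u => extension l Y (s u)) u
    = extension (averaging l) Y (s u).
Proof.
move=> sh u; rewrite -averaging_extension.
have idh : is_ectr_hom N N (fun _ m => m) by [].
have eh := extension_ectr_hom _ sh.
have := P_nat _ _ _ _ _ _ _ eh idh lh Y (free_unit Y u).
rewrite extension_unit; last exact: sh.1.
move=> <-; rewrite /averaging; apply: P_ext => Z n.
exact/esym/(lh.2 _ _ _ (linear_comp sh.1 (lin_linear n))).
Qed.

End Averaging.

Definition universal_unit (X : Ob C) (y : RA) : free_mod X (tensor_module A RA A) X :=
  free_unit X (tpure 1 y).

Definition casimir_tensor (X : Ob C) (f : Hc C X X) : tensor A A :=
  averaging (N := free_entwined E X (tensor_module A RA A))
    (universal_unit X) (1 : RA) f.

(** A choice of representative: [W1] asks for formal sums, but constrains them only up to [teq2] and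
    [teq3]. *)
Definition casimir X (f : Hc C X X) : tens2 A A := repr (casimir_tensor X f).

Lemma casimir_pure X f : tev2 tpure (casimir X f) = casimir_tensor X f.
Proof. by rewrite -tensor_pi reprK. Qed.

Lemma casimir_linear X k f g :
  teq2 (casimir X (k *: f + g)) (tscale2 k (casimir X f) ++ casimir X g).
Proof.
apply: teq2P; rewrite tev2_cat tev2_scale; last exact: (tpure_bilinear _ _).1.
by rewrite !casimir_pure /casimir_tensor lin_linear.
Qed.

Lemma universal_unit_linear X : linear (universal_unit X).
Proof. exact: (linear_comp (free_unit_linear X) ((tpure_bilinear _ _).2 _)). Qed.

(* [l] is the image of [universal_unit X] under the entwined extension of the
   A-linear map [x (x) y |-> x . l y]. *)
Lemma averaging_casimir {N : entwined_contramodule E} {X} (l : RA -> cmod N X) :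
  linear l ->
  averaging l 1
  = cpi N X X (fun f => tev2 (fun x y => emu N X (l y) x) (casimir X f)).
Proof.
move=> ll; have [el er] := emu_bilinear _ _ _ N X.
have bil : bilinear_map (fun x y => emu N X (l y) x).
  by split=> x k y z; rewrite ?er // ll el.
pose k : tensor_module A RA A -> cmod N X := tlift (fun x y => emu N X (l y) x).
have kh : module_hom (tensor_module A RA A) (fiber N X) k.
  have kl : linear k by exact: tlift_linear.
  split=> // t a; move: t; apply: tensor_linear_ext.
  - exact: (linear_comp kl (tensor_act_linear A RA A a)).
  - exact: (linear_comp (el a) kl).
  - by move=> u v; rewrite /= tensor_act_pure /k !tlift_pure //= emu_assoc.
have := averaging_post (N := free_entwined E X (tensor_module A RA A)) _
  (universal_unit_linear X) _ (extension_ectr_hom _ kh) 1.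
rewrite [RHS]/extension => <-; congr (averaging _ _); apply/funext => y.
rewrite extension_unit; last exact: kh.1.
by rewrite /k tlift_pure //= emu_one.
Qed.

(** The case of [averaging_casimir] in which [l] takes values in units. The action and the sum stay
    inside the unit, so the contraction collapses by [free_cpi_unit]. *)
Lemma averaging_free_unit X (U : amodule A) (k : RA -> U) f : linear k ->
  averaging (N := free_entwined E X U) (fun y => free_unit X (k y)) (1 : RA) f
  = tev2 (fun x y => act _ U (k y) x) (casimir X f).
Proof.
move=> kl; rewrite averaging_casimir; last exact: (linear_comp (free_unit_linear X) kl).
have [al ar] := act_bilinear _ U.
rewrite -[RHS](free_cpi_unit X X
  (fun f => tev2 (fun x y => act _ U (k y) x) (casimir X f))).
  congr (lin_fun _ _ (free_cpi _ _ _ _ _) _); apply/funext => g.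
  rewrite (linear_tev2 (free_unit X)); last exact: free_unit_linear.
  by apply: eq_tev2 => x y; rewrite -[LHS](free_unit_module_hom X U).2.
apply: tev2_linear_arg; first exact: casimir_linear.
by split=> x a y z; rewrite ?ar // kl al.
Qed.

(** Apply the previous formula to the unit map A -> F_X(A)(X). It is already A-linear, so averaging
    leaves it unchanged. *)
Lemma casimir_mul X (f : Hc C X X) :
  \sum_(q <- casimir X f) q.1 * q.2 = eps C X f *: 1.
Proof.
rewrite -[RHS](free_unitE X (1 : RA)) -[LHS](averaging_free_unit X RA id) //.
rewrite averaging_id //; first exact: free_unit_linear.
exact: free_unit_module_hom.
Qed.

(** Average y |-> eps (1 (x) ya) at 1 in two ways. The explicit formula gives the left side. Right
    multiplication by a is left A-linear, so the average is also a acting on the average of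
    [universal_unit], and the twisted action gives the right side. *)
Lemma casimir_right_mul X (g : Hc C X X) a :
  teq2 [seq (q.1, q.2 * a) | q <- casimir X g]
       [seq (p.1 * q.1, q.2) | p <- psi E X X g a, q <- casimir X p.2].
Proof.
pose T := tensor_module A RA A; pose F := free_entwined E X T.
have [pl pr] := tpure_bilinear A A.
have mul_a : linear (fun y : A => y * a) by exact: (act_bilinear _ RA).2.
pose s (y : RA) := free_unit X ((y * a) : RA).
have sh : module_hom RA (fiber (free_entwined E X RA) X) s.
  split=> [|y b]; first exact: (linear_comp (free_unit_linear X) mul_a).
  by rewrite /s -(free_unit_module_hom X RA).2 /= mulrA.
have ul : linear (universal_unit X : RA -> cmod F X) by exact: universal_unit_linear.
have [al am] := averaging_module_hom _ ul.
have avg_a : averaging (N := F) (fun y : RA => universal_unit X (y * a)) (1 : RA)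
  = emu F X (averaging (N := F) (universal_unit X) (1 : RA)) a.
  have := averaging_pre _ ul _ sh 1; rewrite extension_unit // mul1r => avg1.
  rewrite -[RHS]am /= mulr1 -avg1; congr (averaging (N := F) _ _); apply/funext => y.
  by rewrite extension_unit.
have := averaging_free_unit X T (fun y : RA => tpure (1 : A) (y * a)) g
  (linear_comp (pr 1) mul_a).
rewrite [X in lin_fun _ _ X]avg_a => avg_g.
apply: teq2P; rewrite /tev2 big_map big_allpairs_dep /=.
apply: etrans (etrans (esym avg_g) (etrans (free_actE E X T X _ a g) _)).
  by apply: eq_bigr => q _; rewrite /= tensor_act_pure /= mulr1.
apply: eq_bigr => p _; rewrite -[X in act _ _ X]casimir_pure.
rewrite [LHS](linear_tev2 (fun t => tensor_act A RA A t p.1)).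
  by apply: eq_bigr => q _; rewrite tensor_act_pure.
exact: tensor_act_linear.
Qed.

(* Both sides are the value at [1] of the average of
   [y |-> (f |-> 1 (x) y_psi (x) f^psi) : A -> F_Y(A (x) A (x) C(X, Y))(X)]:
   the right one by [averaging_casimir], the left one because this map factors
   through [l : A (x) C(X, Y) -> F_Y(A (x) A (x) C(X, Y))(Y)]. *)
Lemma casimir_comult X Y (f : Hc C X Y) :
  teq3 [seq (q.1, q.2, p.2) | p <- delta C X Y Y f, q <- casimir Y p.1]
       (flatten (flatten
          [seq [seq [seq (r.1, s.1, s.2) | s <- psi E X Y r.2 q.2]
               | r <- psi E X Y p.1 q.1]
          | p <- delta C X X Y f, q <- casimir X p.2])).
Proof.
pose H := Hc C X Y.
pose V1 := tensor_module A RA H.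
pose V2 := tensor_module A (tensor_module A RA A) H.
pose F1 := free_entwined E Y V1.
pose F2 := free_entwined E Y V2.
have [pl pr] := tpure_bilinear A H.
have [pl' pr'] := tpure_bilinear A A.
have [pl'' pr''] := tpure_bilinear (tensor A A) H.
have jb : bilinear_map (fun (y : A) (h : H) => tpure3 (1 : A) y h).
  by split=> u k y z; rewrite /tpure3 ?pr' ?pr'' ?pl''.
(* A acts on the leftmost factor of [V2], where [j] inserts a 1; hence [l] is linear but need not be
   A-linear. *)
pose j : V1 -> V2 := tlift (fun y h => tpure3 (1 : A) y h).
have jl : linear j by exact: tlift_linear.
pose l (v : V1) : cmod F2 Y := free_unit Y (j v).
have ll : linear l by exact: (linear_comp (free_unit_linear Y) jl).
(* The tautological element of F_Y(A (x) C(X,Y))(X); its multiples y.iota form the A-linear map [s]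
   along which [l'] factors. *)
pose iota : free_mod Y V1 X := to_lin (fun h : H => tpure (1 : A) h).
have iotaE h : iota h = tpure 1 h by exact/to_linE/pr.
pose s (y : RA) : free_mod Y V1 X := emu F1 X iota y.
have sh : module_hom RA (fiber F1 X) s.
  split=> [|y b]; first exact: (emu_bilinear _ _ _ F1 X).2.
  exact/esym/(emu_assoc _ _ _ F1 X iota b y).
have sE y h : s y h = tev2 (fun y' h' => tpure (y' : A) h') (psi E X Y h y).
  rewrite [LHS]free_actE; apply: eq_tev2 => a' h'.
  by rewrite iotaE /= tensor_act_pure /= mulr1.
pose l' (y : RA) : cmod F2 X := extension (N := F2) l X (s y).
have el : linear (extension (N := F2) l X)
  by exact: (extension_ctr_hom (N := F2) l ll).1.
have l'l : linear l' by exact: linear_comp el sh.1.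
have l'E y h : l' y h = tev2 (fun y' h' => tpure3 (1 : A) y' h') (psi E X Y h y).
  rewrite [LHS](free_cpi_unit X Y (fun h => j (s y h))) ?sE ?(linear_tev2 j) //.
    by apply: eq_tev2 => y' h'; rewrite /j tlift_pure.
  exact/(linear_comp jl)/lin_linear.
have [al am] := averaging_module_hom (N := F2) _ ll.
(* For fixed h, restricting [l] along the A-linear map y |-> eps (y (x) h) gives y |-> eps (1 (x) y
   (x) h), whose average is known explicitly. *)
have avg_pure (h : H) g : averaging (N := F2) l (tpure (1 : A) h : V1) g
    = tev2 (fun x y => tpure3 x y h) (casimir Y g).
  pose s' (y : RA) : free_mod Y V1 Y := free_unit Y (tpure y h : V1).
  have s'h : module_hom RA (fiber F1 Y) s'.
    split=> [|y b]; first exact: linear_comp (free_unit_linear Y) (pl h).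
    by rewrite /s' -(free_unit_module_hom Y V1).2 /= tensor_act_pure.
  have := averaging_pre (N := F2) _ ll _ s'h 1; rewrite extension_unit // => <-.
  have kl : linear (fun y : A => tpure3 (1 : A) y h : V2) by exact: jb.1.
  rewrite -[RHS](eq_tev2 (fun x y => act _ V2 (tpure3 (1 : A) y h) x)).
    rewrite -(averaging_free_unit Y V2 _ g kl).
    congr (lin_fun _ _ (averaging (N := F2) _ _) _); apply/funext => y.
    by rewrite extension_unit // /l /j tlift_pure.
  by move=> x y; rewrite /= tensor_act_pure /= tensor_act_pure /= mulr1.
apply: teq3P; rewrite /tev3 big_allpairs_dep big_flatten big_flatten big_allpairs_dep.
(* Since [s 1] is [iota], evaluation at f splits f by [delta] and leaves the average of [l] at 1 (x)
   f_{Y2}, evaluated at f_{Y1}. *)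
transitivity (averaging (N := F2) l' (1 : RA) f).
  rewrite averaging_pre // /s emu_one [RHS]free_cpiE.
    apply: eq_bigr => p _; rewrite iotaE avg_pure.
    by apply: eq_bigr => q _.
  exact: linear_comp al (lin_linear iota).
have [bl br] := emu_bilinear _ _ _ F2 X.
(* Each factor of lambda now passes f_{X1} through one [psi]: the first by the twisted action, the
   second by [l'E]. The leading 1 absorbs the first factor. *)
rewrite averaging_casimir // [LHS]free_cpiE; last first.
  apply: tev2_linear_arg; first exact: casimir_linear.
  by split=> x k y z; rewrite ?br // l'l bl.
apply: eq_bigr => p _; rewrite (linear_tev2 (fun m : free_mod Y V2 X => m p.1)) //.
apply: eq_bigr => q _; rewrite [LHS]free_actE big_map.
apply: eq_bigr => r _; rewrite l'E (linear_tev2 (fun m => act _ V2 m r.1)).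
  rewrite big_map; apply: eq_bigr => t _ /=.
  by rewrite /tpure3 tensor_act_pure /= tensor_act_pure /= mulr1.
exact: (act_bilinear _ V2).1.
Qed.

End SeparableToCasimir.

(** * From lambda to a natural retraction *)

Lemma cpi_sum {K : fieldType} {C : coalgebra K} (N : contramodule C) X Y
    {I : Type} (s : seq I) (F : I -> Hc C X Y -> cmod N Y) :
  (forall i, linear (F i)) ->
  cpi N X Y (fun h => \sum_(i <- s) F i h) = \sum_(i <- s) cpi N X Y (F i).
Proof.
move=> Fl; elim: s => [|i s IHs].
  (* [cpi_linear] yields the value at the zero map by taking the scalar -1 and both functions
     zero. *)
  rewrite big_nil -[RHS](addNr (cpi N X Y (fun=> 0))) -scaleN1r -cpi_linear.
  - by congr (cpi _ _ _ _); apply/funext => h; rewrite big_nil scaler0 addr0.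
  - by move=> k u v; rewrite scaler0 addr0.
  - by move=> k u v; rewrite scaler0 addr0.
rewrite big_cons -IHs -[cpi N X Y (F i)]scale1r -cpi_linear //; last exact: linear_sum_of.
by congr (cpi _ _ _ _); apply/funext => h; rewrite big_cons scale1r.
Qed.

Section CasimirToSeparable.
Context {K : fieldType} {C : coalgebra K} {E : entwining C}.
Variable lam : forall X : Ob C, Hc C X X -> tens2 (alg E) (alg E).
Hypothesis lam_W1 : W1 E lam.
Hypothesis lam_mul : forall (X : Ob C) (f : Hc C X X),
  \sum_(q <- lam X f) q.1 * q.2 = eps C X f *: 1.

Definition casimir_average (M N : entwined_contramodule E)
    (g : forall X, cmod M X -> cmod N X) X (m : cmod M X) : cmod N X :=
  cpi N X X (fun f => tev2 (fun x y => emu N X (g X (emu M X m y)) x) (lam X f)).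

Section CtrHom.
Context {M N : entwined_contramodule E}.
Variable g : forall X, cmod M X -> cmod N X.
Hypothesis g_hom : is_ctr_hom M N g.

Fact sandwich_trilinear X :
  trilinear_map (fun x y m => emu N X (g X (emu M X m y)) x).
Proof.
have gl := g_hom.1 X; have [ml mr] := emu_bilinear _ _ _ M X.
have [nl nr] := emu_bilinear _ _ _ N X.
by split=> x y k u v; rewrite ?nr // ?ml ?mr gl nl.
Qed.

Fact sandwich_linear X m :
  linear (fun f => tev2 (fun x y => emu N X (g X (emu M X m y)) x) (lam X f)).
Proof.
have [tl tr _] := sandwich_trilinear X; have [lam_lin _ _] := lam_W1.
by apply: tev2_linear_arg; [exact: lam_lin | split].
Qed.

Lemma casimir_average_linear X : linear (casimir_average M N g X).
Proof.
move=> k m n; rewrite /casimir_average -cpi_linear; try exact: sandwich_linear.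
have [_ _ tm] := sandwich_trilinear X.
congr (cpi _ _ _ _); apply/funext => f.
exact: (tev2_linear_fun (fun m x y => emu N X (g X (emu M X m y)) x) _ tm).
Qed.

(** Coassociativity in [N] turns both sides into one contraction over C(X,Y), splitting f through X
    on the left and through Y on the right. The first condition of [W1] identifies the two
    integrands. *)
Lemma casimir_average_cpi X Y (phi : Hc C X Y -> cmod M Y) : linear phi ->
  casimir_average M N g X (cpi M X Y phi)
  = cpi N X Y (fun f => casimir_average M N g Y (phi f)).
Proof.
move=> phil; have [lam_lin lam_comult _] := lam_W1.
have [ml mr] := emu_bilinear _ _ _ M Y; have [nl nr] := emu_bilinear _ _ _ N Y.
have [tl tr tm] := sandwich_trilinear Y.
have gl := g_hom.1 Y.
have phi_bil : bilinear_map (fun y f => emu M Y (phi f) y).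
  by split=> u k v w; rewrite ?mr // phil ml.
(* [psi_g] and then [chi] describe the integrand of x.g(y.pi(phi)): moving each of the two actions
   inside the contraction costs one [psi]. *)
pose psi_g y h := tev2 (fun y' f' => g Y (emu M Y (phi f') y')) (psi E X Y h y).
have g_bil : bilinear_map (fun y' f' => g Y (emu M Y (phi f') y')).
  exact: bilinear_comp.
have psi_gl y : linear (psi_g y) by exact: psi_linear_map_l.
have psi_gr h : linear (psi_g^~ h) by exact: psi_linear_map_r.
have psi_g_bil y : bilinear_map (fun x h => emu N Y (psi_g y h) x).
  by split=> u k v w; rewrite ?nr // psi_gl nl.
pose chi x y h := tev2 (fun x' h' => emu N Y (psi_g y h') x') (psi E X Y h x).
have chil x y : linear (chi x y) by exact: psi_linear_map_l.
have emuE x y : emu N X (g X (emu M X (cpi M X Y phi) y)) x = cpi N X Y (chi x y).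
  rewrite emu_cpi // g_hom.2; last exact: psi_linear_map_l.
  rewrite emu_cpi; last exact: linear_comp gl (psi_linear_map_l _ _ _ _ (phi_bil)).
  congr (cpi _ _ _ _); apply/funext => h; apply: eq_tev2 => x' h'.
  by rewrite (linear_tev2 (g Y)).
have chi_bil : bilinear_map (fun f h => tev2 (fun x y => chi x y h) (lam X f)).
  split=> [h|f].
    apply: tev2_linear_arg => //; split=> [y|x]; first exact: psi_linear_map_r.
    apply: tev2_linear_fun => x' h'.
    exact: linear_comp (nl x') (psi_gr h').
  by apply: tev2_linear_fun => x y; exact: chil.
transitivity (cpi N X X
  (fun f => cpi N X Y (fun h => tev2 (fun x y => chi x y h) (lam X f)))).
  congr (cpi _ _ _ _); apply/funext => f.
  by rewrite /tev2 cpi_sum //; apply: eq_bigr => q _; rewrite emuE.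
rewrite (cpi_coassoc _ _ N X X Y) // [RHS](cpi_coassoc _ _ N X Y Y
  (fun f h => tev2 (fun x y => emu N Y (g Y (emu M Y (phi f) y)) x) (lam Y h))).
  congr (cpi _ _ _ _); apply/funext => f.
  have tri : trilinear_map (fun x y h => emu N Y (g Y (emu M Y (phi h) y)) x).
    by split=> u v k w z; rewrite ?tl ?tr // phil tm.
  have := lam_comult X Y f _ _ tri.
  rewrite /tev3 big_allpairs_dep big_flatten big_flatten big_allpairs_dep.
  move=> /esym lamE; apply: etrans (etrans _ lamE) _ => //.
  apply: eq_bigr => p _; apply: eq_bigr => q _; rewrite big_map.
  apply: eq_bigr => r _; rewrite big_map (linear_tev2 (fun w => emu N Y w r.1)) //.
split=> [h|f]; last exact: sandwich_linear.
by apply: tev2_linear_fun => x y; exact: linear_comp (tm x y) phil.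
Qed.

(** The second condition of [W1], evaluated on the bilinear map sending (x, y) to x.g(y.m); the
    entwining condition moves the outer a inside the contraction. *)
Lemma casimir_average_act X m a :
  casimir_average M N g X (emu M X m a) = emu N X (casimir_average M N g X m) a.
Proof.
have [lam_lin _ lam_right] := lam_W1; have [tl tr tm] := sandwich_trilinear X.
have [nl nr] := emu_bilinear _ _ _ N X.
rewrite emu_cpi; last exact: sandwich_linear.
congr (cpi _ _ _ _); apply/funext => f.
have bil : bilinear_map (fun x y => emu N X (g X (emu M X m y)) x) by split.
have lamE := lam_right X f a _ _ bil.
rewrite [LHS]big_map [RHS]big_allpairs_dep in lamE.
apply: etrans (etrans _ lamE) _.
  by apply: eq_bigr => q _; rewrite emu_assoc.
apply: eq_bigr => p _; rewrite [RHS](linear_tev2 (fun w => emu N X w p.1)) //.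
by apply: eq_bigr => q _; rewrite emu_assoc.
Qed.

End CtrHom.

Lemma casimir_average_hom (M N : entwined_contramodule E) g :
  is_ctr_hom M N g -> is_ectr_hom M N (casimir_average M N g).
Proof.
move=> gh; split; first split.
- exact: casimir_average_linear.
- exact: casimir_average_cpi.
- exact: casimir_average_act.
Qed.

(** For A-linear g the integrand becomes lambda1(f) lambda2(f).g(m), which is eps(f) g(m), and
    counitality contracts it to g(m). *)
Lemma casimir_average_id (M N : entwined_contramodule E) g :
  is_ectr_hom M N g -> forall X m, casimir_average M N g X m = g X m.
Proof.
move=> [gh ga] X m; rewrite -[RHS](cpi_counit _ _ N); congr (cpi _ _ _ _).
apply/funext => f; have [nl nr] := emu_bilinear _ _ _ N X.
rewrite -[g X m in RHS](emu_one _ _ _ N X) -(linearZ_fun (emu N X (g X m))) //.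
rewrite -lam_mul linear_sum_fun //; apply: eq_bigr => q _.
by rewrite ga emu_assoc.
Qed.

Lemma casimir_average_nat (M M' N N' : entwined_contramodule E) alpha beta g :
  is_ectr_hom M' M alpha -> is_ectr_hom N N' beta -> is_ctr_hom M N g ->
  forall X m,
    casimir_average M' N' (fun Y x => beta Y (g Y (alpha Y x))) X m
    = beta X (casimir_average M N g X (alpha X m)).
Proof.
move=> [ah aa] [bh ba] gh X m; rewrite bh.2; last exact: sandwich_linear.
congr (cpi _ _ _ _); apply/funext => f.
rewrite (linear_tev2 (beta X)); last exact: bh.1.
by apply: eq_tev2 => x y; rewrite aa ba.
Qed.

Lemma casimir_separable : S_psi_separable E.
Proof.
exists casimir_average; split.
- exact: casimir_average_hom.
- exact: casimir_average_id.
- exact: casimir_average_nat.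
Qed.

End CasimirToSeparable.

Theorem theorem5p6 (K : fieldType) (C : coalgebra K) (E : entwining C) :
  S_psi_separable E <->
  exists lam : forall X : Ob C, Hc C X X -> tens2 (alg E) (alg E),
    W1 E lam /\
    (forall (X : Ob C) (f : Hc C X X),
       \sum_(q <- lam X f) q.1 * q.2 = eps C X f *: 1).
Proof.
split=> [[P [P_hom P_id P_nat]]|[lam [lam_W1 lam_mul]]]; last first.
  exact: casimir_separable lam_W1 lam_mul.
exists (casimir P); split; last exact: casimir_mul.
split; [exact: casimir_linear | exact: casimir_comult | exact: casimir_right_mul].
Qed.
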